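(* Let $n$ be a nonnegative integer. Consider the hexagon with all angles $120^\circ$ and side lengths $2n,2n+3,2n,2n+3,2n,2n+3$ (in cyclic order), drawn in the lattice of unit equilateral triangles, and remove from it the three unit triangles that are the middle border triangles of the three sides of length $2n+3$. The number of rhombus tilings of the remaining region equals $$\big((n+2)_{2n}\big)^6\ \frac{\Big(\prod_{k=0}^{2n}k!\Big)^3\ \prod_{k=0}^{6n+2}k!}{\Big(\prod_{k=0}^{4n+2}k!\Big)^3}\ (n+1)^3(3n+1)(3n+2)^2 .$$
   Context: Notation: $(x)_m=x(x+1)\cdots(x+m-1)$, with $(x)_0=1$. The hexagon has its vertices at lattice points and its sides along lattice lines of the triangular lattice of unit equilateral triangles. For a side of length $2n+3$, the middle border triangle is the unit lattice triangle inside the hexagon having as one of its edges the middle one (the $(n+2)$-nd) of the $2n+3$ unit segments of that side. (For $n=0$ the hexagon degenerates to an equilateral triangle of side length $3$.) A rhombus tile is the union of two unit lattice triangles sharing an edge; a rhombus tiling of a region is a set of rhombus tiles with pairwise disjoint interiors whose union is the region. *)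

(* Defs.v *)
From mathcomp Require Import all_boot all_order all_algebra.
From mathcomp Require Import zify.

Set Implicit Arguments.
Unset Strict Implicit.
Unset Printing Implicit Defensive.

Import Order.TTheory GRing.Theory Num.Theory.
Local Open Scope ring_scope.

(* The point (x, y) stands for x e1 + y e2, where e1, e2 are unit vectors at
   an angle of 60 degrees; these are the vertices of the triangular lattice. *)
Definition point : Type := (int * int)%type.

(* The six unit lattice vectors, counterclockwise. *)
Definition dirs : seq point :=
  [:: (1, 0); (0, 1); (-1, 1); (-1, 0); (0, -1); (1, -1)].

Definition dir (k : nat) : point := nth 0 dirs k.

Definition cross (u v : point) : int := u.1 * v.2 - u.2 * v.1.

Definition side (n k : nat) : nat := if odd k then (2 * n + 3)%N else (2 * n)%N.

(* The boundary is walked counterclockwise: the k-th side, 0 <= k < 6, has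
   direction [dir k] and length [side n k] and starts at [corner n k].  Turning
   by 60 degrees at each corner makes all the angles 120 degrees.  The starting
   corner is chosen so that both coordinates range over 0 .. 4n+3. *)
Definition corner (n k : nat) : point :=
  ((2 * n + 3)%:Z, 0) + \sum_(j < k) dir j *+ side n j.

(* Intersection of the closed half-planes to the left of the six sides.
   Directions are used rather than differences of corners, so that sides of
   length 0 (when n = 0) do no harm. *)
Definition in_hexagon (n : nat) (p : point) : bool :=
  [forall k : 'I_6, 0 <= cross (dir k) (p - corner n k)].

(* The cell with lower left corner (x, y) is cut by its short diagonal into two
   unit triangles: (x, y, false) contains (x, y), (x, y, true) does not. *)
Definition triangle (m : nat) : finType := ('I_m * 'I_m * bool)%type.

Definition vertices (m : nat) (t : triangle m) : seq point :=
  let: (x, y, b) := t in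
  let p : point := ((x : nat)%:Z, (y : nat)%:Z) in
  [:: p + (1, 0); p + (0, 1); if b then p + (1, 1) else p].

Definition share_edge (m : nat) (t u : triangle m) : bool :=
  count (mem (vertices u)) (vertices t) == 2%N.

Definition is_rhombus (m : nat) (B : {set triangle m}) : bool :=
  [exists t, exists u, share_edge t u && (B == [set t; u])].

Definition rhombus_tilings (m : nat) (D : {set triangle m}) :
    {set {set {set triangle m}}} :=
  [set P | partition P D & [forall B in P, is_rhombus B]].

Definition hexagon (n : nat) : {set triangle (4 * n + 3)} :=
  [set t | all (in_hexagon n) (vertices t)].

(* The i-th unit segment of side k, counted from 1, has endpoints
   corner n k + (i-1) dir k and corner n k + i dir k; here i = n + 2. *)
Definition middle_border (n k : nat) : {set triangle (4 * n + 3)} :=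
  [set t in hexagon n |
    (corner n k + dir k *+ n.+1 \in vertices t) &&
    (corner n k + dir k *+ n.+2 \in vertices t)].

Definition holey_hexagon (n : nat) : {set triangle (4 * n + 3)} :=
  hexagon n :\:
    (middle_border n 1 :|: middle_border n 3 :|: middle_border n 5).

Definition rising (x m : nat) : nat := (\prod_(i < m) (x + i))%N.

Lemma point_mulrn (a b : int) m : ((a, b) : point) *+ m = (a * m%:Z, b * m%:Z).
Proof.
rewrite [LHS]surjective_pairing; apply: (f_equal2 pair).
  by rewrite (raddfMn fst) -[LHS]mulr_natr natz.
by rewrite (raddfMn snd) -[LHS]mulr_natr natz.
Qed.

Lemma point_add (a b c d : int) : ((a,b) + (c,d) : point) = (a + c, b + d).
Proof. by []. Qed.

Lemma cornerS n k : corner n k.+1 = corner n k + dir k *+ side n k.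
Proof. by rewrite /corner big_ord_recr addrA. Qed.

Lemma corner0 n : corner n 0 = ((2 * n + 3)%:Z, 0).
Proof. by rewrite /corner big_ord0 addr0. Qed.

Lemma point_eq (a b c d : int) : a = c -> b = d -> (a, b) = (c, d) :> point.
Proof. by move=> -> ->. Qed.

Lemma corner1 n : corner n 1 = ((4 * n + 3)%:Z, 0).
Proof.
rewrite cornerS corner0 /dir [nth _ _ _]/=
  [side _ _]/side [odd _]/= point_mulrn point_add.
by apply: point_eq; lia.
Qed.

Lemma corner2 n : corner n 2 = ((4 * n + 3)%:Z, (2 * n + 3)%:Z).
Proof.
rewrite cornerS corner1 /dir [nth _ _ _]/=
  [side _ _]/side [odd _]/= point_mulrn point_add.
by apply: point_eq; lia.
Qed.

Lemma corner3 n : corner n 3 = ((2 * n + 3)%:Z, (4 * n + 3)%:Z).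
Proof.
rewrite cornerS corner2 /dir [nth _ _ _]/=
  [side _ _]/side [odd _]/= point_mulrn point_add.
by apply: point_eq; lia.
Qed.

Lemma corner4 n : corner n 4 = (0, (4 * n + 3)%:Z).
Proof.
rewrite cornerS corner3 /dir [nth _ _ _]/=
  [side _ _]/side [odd _]/= point_mulrn point_add.
by apply: point_eq; lia.
Qed.

Lemma corner5 n : corner n 5 = (0, (2 * n + 3)%:Z).
Proof.
rewrite cornerS corner4 /dir [nth _ _ _]/=
  [side _ _]/side [odd _]/= point_mulrn point_add.
by apply: point_eq; lia.
Qed.

Lemma corner_closed n : corner n 6 = corner n 0.
Proof.
rewrite cornerS corner5 corner0 /dir [nth _ _ _]/=
  [side _ _]/side [odd _]/= point_mulrn point_add.
by apply: point_eq; lia.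
Qed.

Lemma forall_ord6 (P : nat -> bool) : [forall k : 'I_6, P k] = [&& P 0%N, P 1%N, P 2, P 3, P 4 & P 5]%N.
Proof.
apply/forallP/idP => [H|].
  by apply/and5P; split; rewrite ?(H (@Ordinal 6 0 isT)) ?(H (@Ordinal 6 1 isT))
    ?(H (@Ordinal 6 2 isT)) ?(H (@Ordinal 6 3 isT)) ?(H (@Ordinal 6 4 isT))
    ?(H (@Ordinal 6 5 isT)).
by case/and5P => H0 H1 H2 H3 /andP[H4 H5] [[|[|[|[|[|[|//]]]]]] ?].
Qed.

Lemma crossE (a b c d e f : int) : cross (a, b) ((c,d) - (e,f)) = a * (d - f) - b * (c - e).
Proof. by []. Qed.

(* The hexagon lies in the square [0, 4n+3] x [0, 4n+3], so no
   unit triangle is lost by indexing them with [triangle (4 * n + 3)]. *)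
Lemma in_hexagonE (n : nat) (x y : int) :
  in_hexagon n (x, y) =
    [&& 0 <= x <= (4 * n + 3)%:Z, 0 <= y <= (4 * n + 3)%:Z
      & (2 * n + 3)%:Z <= x + y <= (6 * n + 6)%:Z].
Proof.
rewrite /in_hexagon (forall_ord6 (fun k => 0 <= cross (dir k) ((x, y) - corner n k))).
rewrite corner0 corner1 corner2 corner3 corner4 corner5 /dir ![nth _ _ _]/= !crossE.
apply/idP/idP => H; lia.
Qed.

(* Main.v *)
Require Import Defs.
From mathcomp Require Import all_boot all_order all_algebra.
From mathcomp Require Import perm zify ring.

Set Implicit Arguments.
Unset Strict Implicit.
Unset Printing Implicit Defensive.

Import Order.TTheory GRing.Theory Num.Theory.
Local Open Scope ring_scope.

(** Slice the hexagon into horizontal rows.  In the coordinates of the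
    definitions, a triangle (x, y, true) can be matched with (x, y, false),
    with (x+1, y, false), or with (x, y+1, false) across the line at height
    y+1.  The unit segments of a horizontal line that are not inside a rhombus
    form the state of the tiling at that line; going up one row, each of them
    stays or moves one step to the left, and no two of them collide.  A tiling
    is thus a family of 2n+2 nonintersecting lattice paths.  Of these, 2n start
    on the bottom side, two start at height n+2 on the top edges of the two
    removed triangles of row n+1, and all end on the top side, whose middle
    segment is skipped because of the third removed triangle.

    Nonintersecting paths are counted by the determinant of the numbers of
    single paths.  Here this is proved by peeling triangles off the top of the
    region ([tilings_branch]).  The choice of a triangle (x, y, true) between
    its two neighbours is the Pascal recursion for the corresponding row of the
    determinant ([row_step]), and colliding choices cost nothing, since they
    give two equal rows.  When a removed triangle is met, the determinant loses
    a row and a column ([line_dents]).  The outcome is [holey_det].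

    To evaluate the determinant, add a row for the skipped segment.  Of the
    2n+3 rows of the new matrix [path_mx], 2n are bulk rows
    j |-> C(4n+3, 2n+3+i-j), and three come from the removed triangles.  The
    bulk rows annihilate the three columns
    v_a(j) = (-1)^(j-a) C(2n, j-a) (4n+2-j)! (2n+j)!, a = 0, 1, 2, because
    their pairing is a 2n-th finite difference of a polynomial of degree 2n-1
    ([kervec_bulk]).  Completing these columns with unit vectors to a
    triangular matrix makes the product block triangular ([det_path_mx]).  One
    block is a determinant of binomials with a classical product formula
    ([det_binomial]).  The other is the 3 by 3 matrix of the pairings of the
    three special rows with the v_a, which are binomials up to sign and a common
    factor, and its determinant factors ([det_pairing]). *)

(** * Removing one rhombus from a tiling *)

Definition true_adjoins (x y x' y' : nat) : bool :=
  ((x' == x) && (y' == y)) || ((x' == x.+1) && (y' == y)) || ((x' == x) && (y' == y.+1)).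

Lemma share_edgeE m (x y x' y' : 'I_m) b b' :
  share_edge (x, y, b) (x', y', b') =
    if b then ~~ b' && true_adjoins x y x' y' else b' && true_adjoins x' y' x y.
Proof.
rewrite /share_edge /true_adjoins /=.
case: x y x' y' => x /= _ [y /= _] [x' /= _] [y' /= _].
have e1 (p q : nat) : ((p%:Z + 1 == q%:Z + 1) = (p == q))%R by lia.
have e2 (p q : nat) : ((p%:Z + 1 == q%:Z) = (p.+1 == q))%R by lia.
have e3 (p q : nat) : ((p%:Z == q%:Z + 1) = (p == q.+1))%R by lia.
have e4 (p q : nat) : ((p%:Z == q%:Z) = (p == q))%R by lia.
have excl (p q : nat) : [|| [&& p == q, p.+1 != q & p != q.+1],
    [&& p != q, p.+1 == q & p != q.+1], [&& p != q, p.+1 != q & p == q.+1]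
    | [&& p != q, p.+1 != q & p != q.+1]] by lia.
(* Only the offset of the two cells matters, and each coordinate of it has
   four cases: equal, one more, one less, or anything else. *)
have := excl x x'; have := excl y y'.
case: b; case: b'; rewrite /= ?point_add !inE !xpair_eqE /= ?addr0 ?e1 ?e2 ?e3 ?e4;
  rewrite ?(eq_sym x' x) ?(eq_sym y' y) ?(eq_sym x' x.+1) ?(eq_sym y' y.+1);
  by case: (x == x'); case: (x.+1 == x'); case: (x == x'.+1);
     case: (y == y'); case: (y.+1 == y'); case: (y == y'.+1).
Qed.

Lemma share_edge_sym m (t u : triangle m) : share_edge t u = share_edge u t.
Proof. by case: t u => [[x y] [|]] [[x' y'] [|]]; rewrite !share_edgeE. Qed.

Lemma share_edge_irr m (t : triangle m) : share_edge t t = false.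
Proof. by case: t => [[x y] [|]]; rewrite share_edgeE. Qed.

Lemma tilings_through m (D : {set triangle m}) (t u : triangle m) :
  t \in D -> u \in D -> share_edge t u ->
  #|[set P in rhombus_tilings D | [set t; u] \in P]| = #|rhombus_tilings (D :\ t :\ u)|.
Proof.
move=> tD uD tu.
have ut : u != t by apply: contraTneq tu => ->; rewrite share_edge_irr.
set B := [set t; u].
have DB : D :\ t :\ u = D :\: B by rewrite setDDl.
have rhB : is_rhombus B by apply/existsP; exists t; apply/existsP; exists u; rewrite tu eqxx.
have BnP P : partition P (D :\: B) -> B \notin P.
  move=> partP; apply/negP => BP; have := subsetP (partitionS partP BP) t.
  by rewrite !inE eqxx => /(_ isT).
rewrite DB -[RHS](card_in_imset (f := fun P => B |: P)); last first.
  move=> P Q; rewrite !inE => /andP[pP _] /andP[pQ _] /(congr1 (fun X => X :\ B)).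
  by rewrite /= !setU1K ?BnP.
apply: eq_card => P; rewrite !inE; apply/andP/imsetP => [[/andP[partP rhP] BP]|[Q + ->]].
  exists (P :\ B); last by rewrite setD1K.
  rewrite inE (partitionD1 partP BP) //=; apply/forall_inP => C.
  by rewrite inE => /andP[_ CP]; apply: (forall_inP rhP).
rewrite inE => /andP[partQ rhQ]; rewrite setU11; split=> //; apply/andP; split; last first.
  by apply/forall_inP => C; rewrite inE => /orP[/set1P->//|]; apply: (forall_inP rhQ).
have BD : B \subset D by rewrite subUset !sub1set tD uD.
suff -> : D = B :|: (D :\: B).
  apply: partitionU1 => //; first by apply/set0Pn; exists t; rewrite set21.
  by rewrite disjoint_sym disjoints_subset; apply/subsetP => x; rewrite !inE => /andP[].
by rewrite setDE setUIr setUCr setIT; apply/esym/setUidPr.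
Qed.

(** In each tiling, t lies in exactly one rhombus [set t; u]. *)
Lemma tilings_branch m (D : {set triangle m}) (t : triangle m) : t \in D ->
  #|rhombus_tilings D| =
    (\sum_(u in D | share_edge t u) #|rhombus_tilings (D :\ t :\ u)|)%N.
Proof.
move=> tD.
transitivity (\sum_(u in D | share_edge t u)
    #|[set P in rhombus_tilings D | [set t; u] \in P]|)%N; last first.
  by apply: eq_bigr => u /andP[uD tu]; rewrite tilings_through.
under eq_bigr => u _ do rewrite -sum1dep_card big_mkcondr /=.
rewrite exchange_big -sum1_card /=; apply: eq_bigr => P.
rewrite inE => /andP[partP /forall_inP rhP].
have PtP : pblock P t \in P by rewrite pblock_mem // (cover_partition partP).
have tPt : t \in pblock P t by rewrite mem_pblock (cover_partition partP).
have [u tu Pt] : exists2 u, share_edge t u & pblock P t = [set t; u].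
  have /existsP[t' /existsP[u' /andP[tu' /eqP Pt]]] := rhP _ PtP.
  move: tPt; rewrite Pt !inE => /orP[/eqP->|/eqP->]; first by exists u'.
  by exists t'; rewrite 1?setUC // share_edge_sym.
have uD : u \in D.
  by rewrite -(cover_partition partP); apply/bigcupP; exists (pblock P t); rewrite // Pt !inE eqxx orbT.
rewrite -big_mkcondr (big_pred1 u) // => w /=; rewrite -andbA.
apply/idP/eqP => [/and3P[_ tw twP]|->]; last by rewrite uD tu -Pt PtP.
have := def_pblock (let: And3 _ tP _ := and3P partP in tP) twP (set21 t w).
rewrite Pt => /setP/(_ w); rewrite !inE eqxx orbT => /orP[]/eqP // wt.
by move: tw; rewrite wt share_edge_irr.
Qed.

(** * Regions given by predicates on coordinates *)

(** Regions are handled as predicates on natural coordinates, so that their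
    equalities reduce to linear arithmetic. *)
Definition cells := nat -> nat -> bool -> bool.

Definition region m (p : cells) : {set triangle m} :=
  [set t : triangle m | let: (x, y, b) := t in p x y b].

Definition tilings m (p : cells) : nat := #|rhombus_tilings (region m p)|.

Definition within m (p : cells) := forall x y b, p x y b -> (x < m)%N && (y < m)%N.

Definition del x y b (p : cells) : cells :=
  fun x' y' b' => p x' y' b' && ~~ [&& x' == x, y' == y & b' == b].

Lemma eq_tilings m (p q : cells) :
  (forall x y b, (x < m)%N -> (y < m)%N -> p x y b = q x y b) ->
  tilings m p = tilings m q.
Proof.
move=> pq; rewrite /tilings; congr #|pred_of_set (rhombus_tilings _)|.
by apply/setP => -[[x y] b]; rewrite !inE pq /= ?ltn_ord.
Qed.

Lemma region_del m (p : cells) (x y : 'I_m) b :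
  region m (del x y b p) = region m p :\ (x, y, b).
Proof. by apply/setP => -[[x' y'] b']; rewrite !inE /del !xpair_eqE /= andbC andbA. Qed.

(** A triangle (x, y, true) that cannot be matched upwards has two partners
    left, both in its own row. *)
Lemma tilings_match_true m (p : cells) x y :
  within m p -> p x y true -> p x y.+1 false = false ->
  tilings m p = (p x y false * tilings m (del x y false (del x y true p))
    + p x.+1 y false * tilings m (del x.+1 y false (del x y true p)))%N.
Proof.
move=> wp pt pf; have /andP[xm ym] := wp _ _ _ pt.
pose t : triangle m := (Ordinal xm, Ordinal ym, true).
pose u : triangle m := (Ordinal xm, Ordinal ym, false).
have tD : t \in region m p by rewrite inE.
rewrite /tilings (tilings_branch tD).
have dt : region m p :\ t = region m (del x y true p) by rewrite -region_del.
rewrite dt (bigID (xpred1 u)) /=; congr (_ + _)%N.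
  case pu : (p x y false); last first.
    rewrite mul0n big_pred0 // => v; apply/negP => /andP[/andP[vD _] /eqP vu].
    by move: vD; rewrite vu inE /= /del pu.
  rewrite mul1n (big_pred1 u) ?(region_del _ (Ordinal xm) (Ordinal ym)) // => v /=.
  by rewrite andbC; case: eqP => //= ->; rewrite !inE share_edgeE /true_adjoins /del /= !eqxx pu.
case pv : (p x.+1 y false); last first.
  rewrite mul0n big_pred0 // => -[[x' y'] [|]];
    rewrite !inE share_edgeE /true_adjoins /del !xpair_eqE -?val_eqE /=; first by rewrite !andbF.
  apply/negP => /andP[/andP[px' /orP[/orP[|]|] /andP[/eqP ex /eqP ey]]];
    by move: px'; rewrite ?ex ?ey ?pv ?pf ?eqxx.
have /andP[x1m _] := wp _ _ _ pv.
rewrite mul1n (big_pred1 (Ordinal x1m, Ordinal ym, false))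
  ?(region_del _ (Ordinal x1m) (Ordinal ym)) // => -[[x' y'] [|]] /=;
  rewrite !inE share_edgeE /true_adjoins /del !xpair_eqE -?val_eqE /=; first by rewrite !andbF.
rewrite !andbT; apply/idP/idP => [|/andP[/eqP-> /eqP->]]; last by rewrite pv eqxx; lia.
case/andP => /andP[px' /orP[/orP[|]|] /andP[/eqP ex /eqP ey]];
    by move: px'; rewrite ?ex ?ey ?pv ?pf ?eqxx.
Qed.

(** Once its row has no triangle (_, y+1, true) any more, (x, y+1, false) can
    only be matched downwards. *)
Lemma tilings_match_false m (p : cells) x y :
  within m p -> p x y.+1 false -> (forall x', p x' y.+1 true = false) ->
  tilings m p = (p x y true * tilings m (del x y true (del x y.+1 false p)))%N.
Proof.
move=> wp pt pf; have /andP[xm ym1] := wp _ _ _ pt; have ym := ltnW ym1.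
pose t : triangle m := (Ordinal xm, Ordinal ym1, false).
pose u : triangle m := (Ordinal xm, Ordinal ym, true).
have tD : t \in region m p by rewrite inE.
rewrite /tilings (tilings_branch tD).
have dt : region m p :\ t = region m (del x y.+1 false p) by rewrite -region_del.
rewrite dt; case pv : (p x y true); last first.
  rewrite mul0n big_pred0 // => -[[x' y'] [|]];
    rewrite !inE share_edgeE /true_adjoins /=; last by rewrite !andbF.
  apply/negP => /andP[px' /orP[/orP[|]|] /andP[/eqP ex /eqP ey]]; [..|case: ey => ey];
    by move: px'; rewrite -ey ?pf // -ex pv.
rewrite mul1n (big_pred1 u) ?(region_del _ (Ordinal xm) (Ordinal ym)) // => -[[x' y'] [|]];
  rewrite !inE share_edgeE /true_adjoins !xpair_eqE -?val_eqE /=; last by rewrite !andbF.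
rewrite !andbT; apply/idP/idP => [|/andP[/eqP-> /eqP->]]; last by rewrite pv !eqxx !orbT.
case/andP => px' /orP[/orP[|]|] /andP[/eqP ex /eqP ey]; [..|case: ey => ey];
  by move: px'; rewrite -ey ?pf // ex !eqxx.
Qed.

Lemma tilings_stuck m (p : cells) x :
  within m p -> p x 0%N false -> (forall x', p x' 0%N true = false) ->
  tilings m p = 0%N.
Proof.
move=> wp pt pf; have /andP[xm ym] := wp _ _ _ pt.
pose t : triangle m := (Ordinal xm, Ordinal ym, false).
have tD : t \in region m p by rewrite inE.
rewrite /tilings (tilings_branch tD) big_pred0 // => -[[x' y'] [|]];
  rewrite !inE share_edgeE /true_adjoins /=; last by rewrite !andbF.
by apply/negP => /andP[px' /orP[/orP[|]|] /andP[/eqP ex /eqP ey]];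
  move: px'; rewrite -?ey ?pf.
Qed.

Lemma tilings_empty m (p : cells) : (forall x y b, p x y b = false) -> tilings m p = 1%N.
Proof.
move=> p0; rewrite /tilings.
have -> : region m p = set0 by apply/setP => -[[x y] b]; rewrite !inE p0.
apply/eqP/cards1P; exists set0; apply/setP => P; rewrite !inE partition_set0.
by case: eqP => // ->; apply/forall_inP => B; rewrite inE.
Qed.

(** * Determinants with rows in a sequence *)

(** Rows are functions on all of nat, cut at k; a sequence lets rows be replaced,
    added and removed without dependent types. *)
Definition seq_det k (s : seq (nat -> rat)) : rat :=
  \det (\matrix_(i < k, j < k) nth (fun=> 0) s i j).

Lemma seq_det_add k s1 s2 (u v w : nat -> rat) :
  (size s1 < k)%N -> (forall j, u j = v j + w j) ->
  seq_det k (s1 ++ u :: s2) = seq_det k (s1 ++ v :: s2) + seq_det k (s1 ++ w :: s2).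
Proof.
move=> s1k uvw; rewrite /seq_det.
rewrite (@determinant_multilinear _ _ _ (\matrix_(i < k, j < k) nth (fun=> 0) (s1 ++ v :: s2) i j)
  (\matrix_(i < k, j < k) nth (fun=> 0) (s1 ++ w :: s2) i j) (Ordinal s1k) 1 1) ?mul1r //.
- by rewrite !scale1r; apply/rowP => j; rewrite !mxE !nth_cat /= ltnn subnn /= uvw.
all: apply/matrixP => i j; rewrite !mxE !nth_cat.
all: have := neq_lift (Ordinal s1k) i; rewrite -val_eqE /=.
all: by case: ltnP => // le; case E: (_ - _)%N => //= /negP[]; lia.
Qed.

Lemma seq_det_zero k s1 s2 (u : nat -> rat) :
  (size s1 < k)%N -> (forall j, (j < k)%N -> u j = 0) -> seq_det k (s1 ++ u :: s2) = 0.
Proof.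
move=> s1k u0; rewrite /seq_det (expand_det_row _ (Ordinal s1k)) big1 // => j _.
by rewrite !mxE nth_cat /= ltnn subnn /= u0 ?mul0r.
Qed.

Lemma seq_det_zero_col k s j : (j < k)%N -> (forall u, u \in map (@^~ j) s -> u = 0) -> seq_det k s = 0.
Proof.
move=> jk u0; rewrite /seq_det (expand_det_col _ (Ordinal jk)) big1 // => i _.
rewrite !mxE /=; case: (ltnP i (size s)) => [lt|ge]; last by rewrite nth_default ?mul0r.
have -> : nth (fun=> 0) s i j = 0; last by rewrite mul0r.
by apply: u0; rewrite -(nth_map (fun=>0) 0 (@^~ j)) ?mem_nth ?size_map.
Qed.

Lemma seq_det_dup k s1 s2 (u : nat -> rat) :
  ((size s1).+1 < k)%N -> seq_det k (s1 ++ u :: u :: s2) = 0.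
Proof.
move=> s1k; rewrite /seq_det.
rewrite (@determinant_alternate _ _ _ (Ordinal (ltnW s1k)) (Ordinal s1k)) //.
  by rewrite -val_eqE /=; lia.
by move=> j; rewrite !mxE !nth_cat /= ltnn subnn ltnNge leqnSn /= subSnn.
Qed.

Lemma seq_det_head k s (u : nat -> rat) : u 0%N = 1 -> (forall v, v \in map (@^~ 0%N) s -> v = 0) ->
  seq_det k.+1 (u :: s) = seq_det k [seq (fun v : nat -> rat => v \o S) v | v <- s].
Proof.
move=> u1 s0; rewrite /seq_det (expand_det_col _ ord0) (bigD1 ord0) //= big1 ?addr0; last first.
  move=> i i0; rewrite !mxE /=; case: i i0 => -[//|i] /= ik _.
  case: (ltnP i (size s)) => [lt|ge]; last by rewrite nth_default ?mul0r.
  have -> : nth (fun=> 0) s i 0%N = 0; last by rewrite mul0r.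
  by apply: s0; rewrite -(nth_map (fun=>0) 0 (@^~ 0%N)) ?mem_nth ?size_map.
rewrite !mxE /= u1 mul1r /cofactor addn0 expr0 mul1r; congr (\det _).
apply/matrixP => i j; rewrite !mxE /=.
case: (ltnP i (size s)) => [lt|ge]; last by rewrite !nth_default ?size_map.
by rewrite (nth_map (fun=>0)).
Qed.

Lemma seq_det_last k s (u : nat -> rat) : size s = k -> u k = 1 ->
  (forall v, v \in map (@^~ k) s -> v = 0) ->
  seq_det k.+1 (rcons s u) = seq_det k s.
Proof.
move=> sk u1 s0; rewrite /seq_det (expand_det_col _ ord_max) (bigD1 ord_max) //= big1 ?addr0; last first.
  move=> i i0; rewrite !mxE /= nth_rcons sk.
  have ik : (i < k)%N by rewrite ltn_neqAle -ltnS ltn_ord andbT.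
  rewrite ik.
  have -> : nth (fun=> 0) s i k = 0; last by rewrite mul0r.
  by apply: s0; rewrite -(nth_map (fun=>0) 0 (@^~ k)) ?mem_nth ?size_map ?sk.
rewrite !mxE /= nth_rcons sk ltnn eqxx u1 mul1r /cofactor -signr_odd oddD addbb mul1r; congr (\det _).
apply/matrixP => i j; rewrite !mxE nth_rcons sk.
by rewrite !lift_max ltn_ord.
Qed.

(** * Paths and regions of the hexagon *)

(** The number of ways to go from position a to position x in t steps, each of
    which stays or decreases the position by one. *)
Definition paths t a x : nat := if (x <= a)%N then 'C(t, a - x) else 0%N.

Lemma pathsS t a x : paths t.+1 a x = (paths t a x + paths t a x.+1)%N.
Proof.
rewrite /paths; case: (ltngtP x a) => [lt|gt|->]; last by rewrite subnn !bin0.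
  by rewrite -(subnSK lt) binS addnC.
by [].
Qed.

Definition in_hex n x y (b : bool) : bool :=
  [&& (x < 4 * n + 3)%N, (y < 4 * n + 3)%N &
    (2 * n + 3 - b <= x + y < 6 * n + 6 - b)%N].

(** The three triangles are (n+1, n+1), (4n+2, n+1) and (n+1, 4n+2), all with
    third component true. *)
Definition dent n x y : bool :=
  (y == n.+1) && ((x == n.+1) || (x == 4 * n + 2)%N) || (y == 4 * n + 2)%N && (x == n.+1).

Definition holey n : cells := fun x y b => in_hex n x y b && ~~ (b && dent n x y).

(** What is left of the holey hexagon when it has been peeled down to row y:
    all rows below y; in row y, the triangles (x, y, true) with x in A and the
    triangles (x, y, false) with x not in C.  The paths still to be followed
    downwards are at the positions C on line y and A on line y+1. *)
Definition stage n y (A C : seq nat) : cells := fun x' y' b' =>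
  holey n x' y' b' && ((y' < y)%N || (y' == y) && (if b' then x' \in A else x' \notin C)).

Lemma within_stage n y A C : within (4 * n + 3) (stage n y A C).
Proof. by move=> x y' b /andP[/andP[/and3P[-> -> _] _] _]. Qed.

(** A start is a pair of a position and the height of its line.  The starts are
    listed from left to right, the order in which the paths remain. *)
Definition bottom_starts n : seq (nat * nat) := [seq (x, 0%N) | x <- iota (2 * n + 3) (2 * n)].
Definition all_starts n : seq (nat * nat) :=
  (n.+1, n.+2) :: rcons (bottom_starts n) ((4 * n + 2)%N, n.+2).
(** The two starts at height n+2 appear between the lines n+1 and n+2. *)
Definition starts n y := if (y <= n.+1)%N then bottom_starts n else all_starts n.

(** The row of the path matrix that belongs to position x on line y. *)
Definition arrivals (st : seq (nat * nat)) y x : nat -> rat := fun j =>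
  let: (a, s) := nth (0, 0)%N st j in (paths (y - s) a x)%:R.

(** * One row of the tiling *)

Lemma stage_true n y a (A C : seq nat) :
  sorted ltn (a :: A) -> (forall c, c \in C -> (c <= a)%N) -> holey n a y true ->
  tilings (4 * n + 3) (stage n y (a :: A) C) =
    ((in_hex n a y false && (a \notin C)) * tilings (4 * n + 3) (stage n y A (rcons C a))
   + in_hex n a.+1 y false * tilings (4 * n + 3) (stage n y A (rcons C a.+1)))%N.
Proof.
move=> sA Ca ha.
have aA : a \notin A.
  by apply/negP => /(allP (order_path_min ltn_trans sA)); rewrite ltnn.
have stageF x : stage n y (a :: A) C x y false = in_hex n x y false && (x \notin C).
  by rewrite /stage /holey ltnn eqxx /= andbT.
rewrite (tilings_match_true (within_stage (n:=n) (y:=y) (A:=a :: A) (C:=C)) (x:=a) (y:=y)); last first.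
- by rewrite /stage; lia.
- by rewrite /stage ha eqxx mem_head orbT.
have aC : a.+1 \notin C by apply/negP => /Ca; rewrite ltnn.
rewrite !stageF aC andbT.
have upd x : tilings (4 * n + 3) (del x y false (del a y true (stage n y (a :: A) C))) =
    tilings (4 * n + 3) (stage n y A (rcons C x)).
  apply: eq_tilings => x' y' b' _ _; rewrite /del /stage.
  case: holey => //=; case: (ltngtP y' y) => //= _; rewrite ?andbF //.
  case: b'; rewrite ?mem_rcons ?inE /= ?andbT ?andbF /= ?negb_or 1?andbC //.
    by rewrite /=; case: (x' =P a) => [->|_]; rewrite ?(negbTE aA) ?andbT.
  by rewrite andbT andbC.
by rewrite !upd.
Qed.

Lemma nth_bottom n i : (i < 2 * n)%N ->
  nth (0, 0)%N (bottom_starts n) i = ((2 * n + 3 + i)%N, 0%N).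
Proof. by move=> lt; rewrite (nth_map 0%N) ?size_iota ?nth_iota. Qed.

Lemma size_bottom n : size (bottom_starts n) = (2 * n)%N.
Proof. by rewrite size_map size_iota. Qed.

Lemma size_starts n y : size (starts n y) = (if (y <= n.+1) then 2 * n else 2 * n + 2)%N.
Proof. by rewrite /starts; case: ifP => _; rewrite /= ?size_rcons ?size_map size_iota; lia. Qed.

Lemma nth_starts n y j : (j < size (starts n y))%N ->
  let: (a, s) := nth (0, 0)%N (starts n y) j in
  [&& s <= y, a < 4 * n + 3 & 2 * n + 3 <= a + s]%N.
Proof.
rewrite size_starts /starts; case: ifP => yn jk; first by rewrite nth_bottom //; lia.
case: j jk => [|j] jk /=; first by lia.
rewrite nth_rcons size_bottom; case: ltnP => [lt|ge]; first by rewrite nth_bottom //; lia.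
by case: eqP => [e|]; lia.
Qed.

(** Paths never leave the hexagon through its left or right boundary, so the
    choices that would do so contribute a zero row. *)
Lemma arrivals_stray n y x j : (j < size (starts n y))%N ->
  (x + y < 2 * n + 3)%N || (4 * n + 3 <= x)%N -> arrivals (starts n y) y x j = 0.
Proof.
move=> /nth_starts; rewrite /arrivals /paths; case: nth => a s /and3P[sy aN as_] xy.
case: leqP => // xa; rewrite bin_small //; lia.
Qed.

Lemma arrivalsS n y x j :
  arrivals (starts n y) y.+1 x j = arrivals (starts n y) y x j + arrivals (starts n y) y x.+1 j.
Proof.
rewrite /arrivals; case: (ltnP j (size (starts n y))) => [|ge].
  by move=> /nth_starts; case: nth => a s /and3P[sy _ _]; rewrite subSn // pathsS natrD.
by rewrite nth_default // !subn0 pathsS natrD.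
Qed.

(** If the determinant counts the tilings of all stages that have been peeled
    down to line y, then it also does when paths are pending on line y+1:
    following the leftmost pending path one step down splits its row by the
    Pascal recursion.  The invariant that C lies weakly to the left of A means
    that a collision repeats the last row of C, which makes the determinant
    vanish as it should. *)
Lemma row_step n y :
  (forall C, sorted ltn C -> (forall c, c \in C -> in_hex n c y false) ->
    size C = size (starts n y) ->
    (tilings (4 * n + 3) (stage n y [::] C))%:R =
      seq_det (size (starts n y)) [seq arrivals (starts n y) y c | c <- C]) ->
  forall A C, sorted ltn A -> sorted ltn C -> (forall c, c \in C -> in_hex n c y false) ->
    (forall a, a \in A -> holey n a y true) -> (forall c a, c \in C -> a \in A -> (c <= a)%N) ->
    (size C + size A)%N = size (starts n y) ->
    (tilings (4 * n + 3) (stage n y A C))%:R =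
      seq_det (size (starts n y)) ([seq arrivals (starts n y) y c | c <- C]
           ++ [seq arrivals (starts n y) y.+1 a | a <- A]).
Proof.
move=> base; elim=> [|a A IH] C sA sC hC hA CA szCA.
  by rewrite cats0 base // -szCA addn0.
rewrite /= in szCA.
have ha : holey n a y true by apply: hA; rewrite mem_head.
have Ca c : c \in C -> (c <= a)%N by move=> cC; apply: CA; rewrite ?mem_head.
have aA b : b \in A -> (a < b)%N by apply/allP: b; apply: (order_path_min ltn_trans sA).
have sA' := path_sorted sA.
rewrite stage_true // natrD !natrM /=.
rewrite (@seq_det_add _ _ _ _ _ _ _ (arrivalsS n y a)) ?size_map; last by lia.
have next x : (a <= x <= a.+1)%N -> x \notin C ->
   (in_hex n x y false)%:R * (tilings (4 * n + 3) (stage n y A (rcons C x)))%:R =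
     seq_det (size (starts n y)) ([seq arrivals (starts n y) y c | c <- C]
           ++ arrivals (starts n y) y x :: [seq arrivals (starts n y) y.+1 a | a <- A]).
  move=> ax xC; case hx: (in_hex n x y false); last first.
    rewrite mul0r seq_det_zero // ?size_map; first by lia.
    move=> j jk; apply: arrivals_stray => //.
    by move: ha ax hx; rewrite /holey /in_hex; lia.
  rewrite mul1r IH //.
  - by rewrite map_rcons cat_rcons.
  - rewrite (sorted_pairwise ltn_trans) pairwise_rcons -(sorted_pairwise ltn_trans) sC andbT.
    apply/allP => c cC; rewrite ltn_neqAle (leq_trans (Ca _ cC)) ?andbT; last by lia.
    by apply: contraNneq xC => <-.
  - by move=> c; rewrite mem_rcons inE => /orP[/eqP->|/hC].
  - by move=> b bA; apply: hA; rewrite inE bA orbT.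
  - move=> c b; rewrite mem_rcons inE => /orP[/eqP->|cC] bA; first by have := aA _ bA; lia.
    by apply: CA; rewrite // inE bA orbT.
  - by rewrite size_rcons; lia.
congr (_ + _); last first.
  by apply: next; [lia|apply/negP => /Ca; rewrite ltnn].
(* Moving to a.+1 never collides; staying at a collides iff a is already in C. *)
case aC: (a \in C); last by rewrite -next ?aC ?andbT //; lia.
rewrite andbF mul0r.
case/lastP: C sC Ca aC szCA {next CA hC IH base} => // C c sC Ca aC szCA.
have -> : c = a.
  apply/eqP; rewrite eqn_leq Ca ?mem_rcons ?mem_head //=.
  move: sC aC; rewrite (sorted_pairwise ltn_trans) pairwise_rcons mem_rcons inE.
  by move=> /andP[/allP lt _] /orP[/eqP->//|/lt/ltnW].
rewrite map_rcons cat_rcons seq_det_dup // size_map; move: szCA; rewrite size_rcons; lia.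
Qed.

(** The regions met while the remaining triangles (x, y+1, false) are matched one
    by one.  They contain all rows below y, all triangles (_, y, false), the
    triangles (x, y, true) with W x, and the triangles (x, y+1, false) with x in
    Q, each of which must be matched with (x, y, true). *)
Definition forced n y (W : pred nat) (Q : seq nat) : cells := fun x' y' b' =>
  [|| holey n x' y' b' && ((y' < y)%N || ((y' == y) && ~~ b')),
      [&& y' == y, b', x' < 4 * n + 3, y' < 4 * n + 3 & W x']%N |
      [&& y' == y.+1, ~~ b', x' < 4 * n + 3, y' < 4 * n + 3 & x' \in Q]%N].

Lemma tilings_forced n y (W : pred nat) (Q : seq nat) : uniq Q ->
  (y.+1 < 4 * n + 3)%N -> {in Q, forall x, (x < 4 * n + 3)%N} ->
  tilings (4 * n + 3) (forced n y W Q) =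
    (all W Q * tilings (4 * n + 3) (forced n y (fun x => W x && (x \notin Q)) [::]))%N.
Proof.
move=> + yN; elim: Q W => [|x Q IH] W /=.
  by move=> _ _; rewrite mul1n; apply: eq_tilings => x' y' b _ _; rewrite /forced andbT.
move=> /andP[xQ uQ] QN.
have QN' : {in Q, forall x, (x < 4 * n + 3)%N} by move=> z zQ; apply: QN; rewrite inE zQ orbT.
have xN : (x < 4 * n + 3)%N by apply: QN; rewrite mem_head.
rewrite (@tilings_match_false _ _ x y); first last.
- move=> x'; rewrite /forced /holey; lia.
- by rewrite /forced xN yN mem_head eqxx /= !orbT.
- move=> x' y' b; rewrite /forced /holey /in_hex; lia.
have -> : forced n y W (x :: Q) x y true = W x.
  by rewrite /forced ltnn eqxx xN (ltnW yN) /= !andbF /= orbF.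
case Wx: (W x); rewrite ?mul0n // !mul1n.
transitivity (tilings (4 * n + 3) (forced n y (fun z => W z && (z != x)) Q)).
  apply: eq_tilings => x' y' b _ _; rewrite /del /forced inE.
  by case: b; case: (ltngtP y' y) => [lt|gt|->]; case: (x' =P x) => [->|_];
    rewrite /= ?(negbTE xQ) ?ltnn ?andbT ?andbF ?orbF ?eqxx //=; try lia.
rewrite IH //; congr (_ * _)%N.
  congr nat_of_bool; apply: eq_in_all => z zQ.
  by rewrite andb_idr // => _; apply: contraNneq xQ => <-.
apply: eq_tilings => x' y' b _ _; rewrite /forced inE negb_or; congr [|| _, [&& _, _, _, _ & _] | _].
by rewrite -andbA.
Qed.

(** The triangles (x, y+1, false) with x outside C are all matched downwards,
    which fails iff one of them sits above a removed triangle.  What remains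
    of row y+1 is the state C, less the paths that start on this line. *)
Lemma stage_forced n y C : (y.+1 < 4 * n + 3)%N -> {in C, forall c, in_hex n c y.+1 false} ->
  tilings (4 * n + 3) (stage n y.+1 [::] C) =
    (all (mem C) [seq x <- iota 0 (4 * n + 3) | dent n x y] *
     tilings (4 * n + 3) (stage n y [seq c <- C | ~~ dent n c y] [::]))%N.
Proof.
move=> yN hC.
pose Q := [seq x <- iota 0 (4 * n + 3) | in_hex n x y.+1 false & x \notin C].
have memQ x : (x \in Q) = in_hex n x y.+1 false && (x \notin C).
  by rewrite mem_filter mem_iota andb_idr // /in_hex; lia.
have in_hexS x : in_hex n x y.+1 false = in_hex n x y true.
  by move: yN; rewrite /in_hex; lia.
transitivity (tilings (4 * n + 3) (forced n y (fun x => holey n x y true) Q)).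
  apply: eq_tilings => x' y' b _ _; rewrite /stage /forced memQ in_nil.
  have [->|ne] := eqVneq y' y.+1.
    rewrite ltnn /=; case: b => /=; rewrite ?andbF ?andbT /=; first by lia.
    rewrite /holey /= andbT /in_hex; lia.
  have [->|ne2] := eqVneq y' y; last by rewrite /holey /in_hex /=; lia.
  by case: b; rewrite ltnSn /holey /in_hex /=; lia.
rewrite tilings_forced ?filter_uniq ?iota_uniq //; last by move=> x; rewrite memQ /in_hex; lia.
congr (nat_of_bool _ * _)%N; last first.
  apply: eq_tilings => x' y' b xN _; rewrite /stage /forced memQ in_nil mem_filter /=.
  have [->|ne2] := eqVneq y' y; last by rewrite /holey /in_hex /=; lia.
  rewrite ltnn xN (ltnW yN) /=; case: b => /=; rewrite ?andbT ?andbF ?orbF //=.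
  have := hC x'; rewrite in_hexS /holey /=; case: (x' \in C) => [/(_ isT)->|_].
    by case: dent.
  by rewrite !andbF; case: in_hex; rewrite /= ?andbF.
apply/allP/allP => [H x|H x].
  rewrite mem_filter mem_iota => /andP[dx xN]; apply/negPn/negP => xC.
  have : x \in Q by rewrite memQ xC andbT; move: dx xN yN; rewrite /dent /in_hex; lia.
  by move=> /H; rewrite /holey dx andbF.
rewrite memQ /holey in_hexS => /andP[hx xC]; rewrite hx /=; apply/negP => dx.
have xD : x \in [seq x <- iota 0 (4 * n + 3) | dent n x y].
  by rewrite mem_filter dx mem_iota /=; move: hx; rewrite /in_hex; lia.
by have := H x xD; rewrite inE (negbTE xC).
Qed.

(** * The tilings as a determinant of path numbers *)

Lemma eq_seq_det_map k (C : seq nat) (f g : nat -> nat -> rat) :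
  {in C, forall c j, (j < k)%N -> f c j = g c j} ->
  seq_det k (map f C) = seq_det k (map g C).
Proof.
move=> fg; rewrite /seq_det; congr (\det _); apply/matrixP => i j; rewrite !mxE.
case: (ltnP i (size C)) => [lt|ge]; last by rewrite !nth_default ?size_map.
by rewrite !(nth_map 0%N) // fg // mem_nth.
Qed.

Lemma paths0 a x : paths 0 a x = (x == a).
Proof.
rewrite /paths bin0n; case: (ltngtP x a) => // [lt|->]; last by rewrite subnn.
by rewrite subn_eq0 leqNgt lt.
Qed.

Lemma line0_count n C : sorted ltn C -> (forall c, c \in C -> in_hex n c 0%N false) ->
  size C = size (starts n 0) ->
  (tilings (4 * n + 3) (stage n 0 [::] C))%:R =
     seq_det (size (starts n 0)) [seq arrivals (starts n 0) 0 c | c <- C].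
Proof.
move=> sC hC szC.
have [/allP sub|/allPn[x]] := boolP (all (mem C) (iota (2 * n + 3) (2 * n))).
  have -> : C = iota (2 * n + 3) (2 * n).
    apply: (irr_sorted_eq ltn_trans ltnn sC (iota_ltn_sorted _ _)) => x.
    by apply/idP/idP => [/hC|/sub//]; rewrite mem_iota /in_hex; lia.
  rewrite tilings_empty; last first.
    by move=> x y b; rewrite /stage in_nil mem_iota /holey /in_hex; case: b; lia.
  rewrite /seq_det size_starts /=; set M := (\matrix_(_, _) _).
  suff -> : M = 1%:M by rewrite det1.
  apply/matrixP => i j; rewrite !mxE (nth_map 0%N) ?size_iota // nth_iota //.
  by rewrite /arrivals /starts /= nth_bottom // paths0 eqn_add2l.
(* A missing position x leaves (x, 0, false) without partner, and the column of
   the start x vanishes. *)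
rewrite mem_iota => xi; rewrite inE => xC.
have ltx : (x - (2 * n + 3) < 2 * n)%N by lia.
rewrite (@tilings_stuck _ _ x (within_stage (A:=[::]) (C:=C))); last first.
- by move=> x'; rewrite /stage /= andbF.
- by rewrite /stage xC /= /holey /in_hex; lia.
rewrite (@seq_det_zero_col _ _ (x - (2 * n + 3))) ?size_starts // => u.
rewrite -map_comp => /mapP[c cC ->]; rewrite /= /arrivals /starts /= nth_bottom // paths0.
case: eqP => // e; have xc : x = c by lia.
by move: xC; rewrite xc cC.
Qed.

(** On the line where they start, the two new paths have columns that are zero
    except at their own position, and these positions are the first and the
    last of the line.  So the determinant vanishes unless both positions are
    occupied, and then expansion along the two columns removes them with
    sign +1. *)
Lemma line_dents n C : sorted ltn C -> (forall c, c \in C -> in_hex n c n.+2 false) ->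
  size C = (2 * n + 2)%N ->
  seq_det (2 * n + 2) [seq arrivals (all_starts n) n.+2 c | c <- C] =
   (all (mem C) [:: n.+1; 4 * n + 2])%:R *
     seq_det (2 * n) [seq arrivals (bottom_starts n) n.+2 c | c <- [seq c <- C | ~~ dent n c n.+1]] /\
  (all (mem C) [:: n.+1; 4 * n + 2] -> size [seq c <- C | ~~ dent n c n.+1] = 2 * n)%N.
Proof.
move=> sC hC szC.
have arr0 c : arrivals (all_starts n) n.+2 c 0%N = (c == n.+1)%:R.
  by rewrite /arrivals /= subnn paths0.
have arrL c : arrivals (all_starts n) n.+2 c (2 * n).+1 = (c == 4 * n + 2)%N%:R.
  by rewrite /arrivals /= nth_rcons size_bottom ltnn eqxx subnn paths0.
have arrM c j : (j < 2 * n)%N ->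
    arrivals (all_starts n) n.+2 c j.+1 = arrivals (bottom_starts n) n.+2 c j.
  by move=> jn; rewrite /arrivals /= nth_rcons size_bottom jn.
rewrite /= andbT.
case n1C: (n.+1 \in C); last first.
  split=> //; rewrite mul0r (@seq_det_zero_col _ _ 0) //; first by lia.
  move=> u; rewrite -map_comp => /mapP[c cC ->] /=; rewrite arr0.
  by case: eqP => // e; rewrite -e cC in n1C.
case nLC: (4 * n + 2 \in C)%N; last first.
  split=> //; rewrite mul0r (@seq_det_zero_col _ _ (2 * n).+1) //; first by lia.
  move=> u; rewrite -map_comp => /mapP[c cC ->] /=; rewrite arrL.
  by case: eqP => // e; rewrite -e cC in nLC.
have [C' EC] : exists C', C = n.+1 :: rcons C' (4 * n + 2)%N.
  case: C sC hC szC n1C nLC => // c C sC hC _ n1C nLC.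
  have ec : c = n.+1.
    move: n1C; rewrite inE => /orP[/eqP->//|/(allP (order_path_min ltn_trans sC))].
    by have := hC c (mem_head _ _); rewrite /in_hex; lia.
  rewrite {}ec in sC hC n1C nLC *.
  case/lastP: C sC hC nLC {n1C} => [|C d] sC hC nLC.
    by move: nLC; rewrite !inE; lia.
  exists C; congr (_ :: rcons _ _).
  have hd : in_hex n d n.+2 false by apply: hC; rewrite inE mem_rcons mem_head orbT.
  move: nLC; rewrite inE mem_rcons inE => /or3P[|/eqP->//|dC]; first by lia.
  move: sC; rewrite /= => /path_sorted; rewrite (sorted_pairwise ltn_trans) pairwise_rcons.
  by case/andP => /allP/(_ _ dC) lt; move: hd; rewrite /in_hex; lia.
move: sC; rewrite EC /= => sC.
have mid : {in C', forall c, (c != n.+1) && (c != (4 * n + 2)%N)}.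
  move=> c cC; have := order_path_min ltn_trans sC; rewrite all_rcons => /andP[_ /allP/(_ _ cC) lt].
  move: sC => /path_sorted; rewrite (sorted_pairwise ltn_trans) pairwise_rcons.
  by case/andP => /allP/(_ _ cC) lt' _; lia.
have dL : dent n n.+1 n.+1 by rewrite /dent !eqxx.
have dR : dent n (4 * n + 2)%N n.+1 by rewrite /dent !eqxx orbT.
have fil : [seq c <- rcons C' (4 * n + 2)%N | ~~ dent n c n.+1] = C'.
  rewrite filter_rcons dR /=; apply/all_filterP/allP => c /mid.
  by rewrite /dent eqxx; lia.
rewrite dL /= fil mul1r; move: szC; rewrite EC /= size_rcons => szC; split; last by lia.
have -> : (2 * n + 2)%N = (2 * n).+2 by lia.
rewrite seq_det_head; first last.
- move=> u; rewrite -map_comp map_rcons mem_rcons inE => /orP[/eqP->/=|/mapP[c cC ->]/=];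
    rewrite arr0; first by case: eqP => //; lia.
  by have /andP[/negPf->] := mid _ cC.
- by rewrite arr0 eqxx.
rewrite map_rcons map_rcons seq_det_last; first last.
- move=> u; rewrite -!map_comp => /mapP[c cC ->] /=; rewrite arrL.
  by have /andP[_ /negPf->] := mid _ cC.
- by rewrite /= arrL eqxx.
- by rewrite !size_map; lia.
by rewrite -map_comp; apply: eq_seq_det_map => c _ j /= jn; rewrite arrM.
Qed.

Lemma line_count n y : (y < 4 * n + 3)%N -> forall C, sorted ltn C ->
  (forall c, c \in C -> in_hex n c y false) -> size C = size (starts n y) ->
  (tilings (4 * n + 3) (stage n y [::] C))%:R =
     seq_det (size (starts n y)) [seq arrivals (starts n y) y c | c <- C].
Proof.
elim: y => [|y IH] yN C sC hC szC; first exact: line0_count.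
rewrite stage_forced // natrM.
set A := [seq c <- C | ~~ dent n c y].
have stepA : size A = size (starts n y) ->
   (tilings (4 * n + 3) (stage n y A [::]))%:R =
      seq_det (size (starts n y)) [seq arrivals (starts n y) y.+1 a | a <- A].
  move=> szA; rewrite (row_step (IH (ltnW yN))) //; first exact: sorted_filter ltn_trans _ _ sC.
  by move=> a; rewrite mem_filter /holey => /andP[-> /hC]; rewrite /in_hex; lia.
have [y1|y1] := eqVneq y n.+1; last first.
  have nodent x : dent n x y = false by rewrite /dent; lia.
  have AC : A = C by apply/all_filterP/allP => c _; rewrite nodent.
  have st : starts n y.+1 = starts n y by rewrite /starts; do 2 case: ifP => //; lia.
  rewrite AC st in stepA *; rewrite (eq_filter nodent) filter_pred0 mul1r stepA //.
  by rewrite szC st.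
subst y.
have st : starts n n.+2 = all_starts n by rewrite /starts ltnn.
have st' : starts n n.+1 = bottom_starts n by rewrite /starts leqnn.
have szC' : size C = (2 * n + 2)%N by rewrite szC size_starts ltnn.
have -> : all (mem C) [seq x <- iota 0 (4 * n + 3) | dent n x n.+1] = all (mem C) [:: n.+1; 4 * n + 2]%N.
  apply: eq_all_r => x; rewrite mem_filter mem_iota !inE /dent; lia.
have [Edet szA] := @line_dents n C sC hC szC'.
rewrite -szC szC' st Edet.
case: (all (mem C) _) szA => szA; last by rewrite !mul0r.
by rewrite !mul1r stepA st' ?size_bottom ?szA.
Qed.

(** On the top line the positions are 0, ..., 2n+2 without n+1, that is, the
    image of bump n.+1. *)
Lemma holey_det n :
  (tilings (4 * n + 3) (holey n))%:R =
  seq_det (2 * n + 2)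
    [seq arrivals (all_starts n) (4 * n + 3) (bump n.+1 j) | j <- iota 0 (2 * n + 2)].
Proof.
pose A := [seq bump n.+1 j | j <- iota 0 (2 * n + 2)].
have memA x : (x \in A) = (x != n.+1) && (x < 2 * n + 3)%N.
  apply/mapP/andP => [[j]|[xn xl]]; first by rewrite mem_iota /bump => ? ->; lia.
  by exists (unbump n.+1 x); rewrite ?mem_iota ?unbumpK // /unbump; lia.
have sA : sorted ltn A.
  by apply: homo_sorted (iota_ltn_sorted 0 (2 * n + 2)) => i j /=; rewrite /bump; lia.
have yN : (4 * n + 2 < 4 * n + 3)%N by lia.
have -> : tilings (4 * n + 3) (holey n) = tilings (4 * n + 3) (stage n (4 * n + 2) A [::]).
  by apply: eq_tilings => x y [] _ _; rewrite /stage ?memA ?in_nil /holey /in_hex /dent; lia.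
have st : starts n (4 * n + 2) = all_starts n by rewrite /starts ifF //; lia.
have sz : size (starts n (4 * n + 2)) = (2 * n + 2)%N by rewrite size_starts ifF //; lia.
rewrite (row_step (line_count yN)) //=.
- by rewrite sz st -addnS -map_comp.
- by move=> a; rewrite memA /holey /in_hex /dent; lia.
by rewrite sz size_map size_iota.
Qed.

Lemma holey_hexagonE n : holey_hexagon n = region (4 * n + 3) (holey n).
Proof.
have addE (a b c d : int) : ((a, b) + (c, d) : point) = (a + c, b + d) by [].
apply/setP => -[[[x xN] [y yN]] b]; rewrite /holey_hexagon /middle_border /hexagon /region !inE /=.
rewrite corner1 corner3 corner5 /dir ![nth _ _ _]/= !point_mulrn.
have hexE : [&& in_hexagon n (x%:Z + 1, y%:Z + 0), in_hexagon n (x%:Z + 0, y%:Z + 1),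
    in_hexagon n (if b then (x%:Z + 1, y%:Z + 1) else (x%:Z, y%:Z)) & true] = in_hex n x y b.
  by rewrite !in_hexagonE /in_hex; case: b; rewrite !in_hexagonE /=; lia.
rewrite !addE hexE !xpair_eqE /holey /dent; case: (boolP (in_hex n x y b)) => //=; rewrite ?andbF //.
rewrite andbT /in_hex; clear hexE; case: b => /= hx; rewrite !xpair_eqE -?negb_or.
  congr (~~ _); rewrite orbAC; congr orb.
    by rewrite [RHS]andb_orr [RHS]orbC; congr orb; apply/idP/idP; lia.
  by apply/idP/idP; lia.
by rewrite !negb_or -andbA; apply/and3P; split; apply/negP => /andP[/or3P[] /andP[]]; lia.
Qed.

(** * Alternating binomial sums *)

(** Up to sign, the M-th finite difference of f at 0. *)
Definition altsum M (f : nat -> rat) : rat :=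
  \sum_(e < M.+1) (-1) ^+ e * 'C(M, e)%:R * f e.

Lemma eq_altsum M f g : (forall e, (e <= M)%N -> f e = g e) -> altsum M f = altsum M g.
Proof. by move=> fg; apply: eq_bigr => e _; rewrite fg // -ltnS. Qed.

Lemma altsumS M f : altsum M.+1 f = altsum M f - altsum M (f \o S).
Proof.
rewrite /altsum big_ord_recl bin0 expr0 mul1r.
under eq_bigr => e _ do rewrite lift0 binS natrD mulrDr mulrDl.
rewrite big_split /= addrA; congr (_ + _); last first.
  by rewrite -sumrN; apply: eq_bigr => e _; rewrite exprS mulN1r !mulNr.
rewrite [RHS]big_ord_recl bin0 expr0 mul1r big_ord_recr /= bin_small // mulr0 mul0r addr0.
by congr (_ + _); apply: eq_bigr => e _; rewrite lift0.
Qed.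

Lemma altsum_rev M f : altsum M f = (-1) ^+ M * altsum M (fun e => f (M - e)%N).
Proof.
rewrite /altsum big_distrr (reindex_inj rev_ord_inj) /=; apply: eq_bigr => e _.
have eM : (e <= M)%N by rewrite -ltnS.
rewrite subSS bin_sub // !mulrA -exprD; congr (_ * _ * _).
rewrite -signr_odd -[RHS]signr_odd; congr (_ ^+ nat_of_bool _); lia.
Qed.

Lemma altsumB M f g : altsum M (fun e => f e - g e) = altsum M f - altsum M g.
Proof. by rewrite /altsum -sumrB; apply: eq_bigr => e _; rewrite mulrBr. Qed.

Lemma altsumZ M f c : altsum M (fun e => c * f e) = c * altsum M f.
Proof. by rewrite /altsum big_distrr; apply: eq_bigr => e _; rewrite /= mulrCA. Qed.

Lemma altsum_bin M T r : (M <= T)%N ->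
  altsum M (fun e => 'C(T - e, r + M)%:R) = 'C(T - M, r)%:R.
Proof.
elim: M T r => [|M IH] T r MT.
  by rewrite /altsum big_ord1 expr0 bin0 !mul1r subn0 addn0.
have eT e : ((fun e => 'C(T - e, r + M.+1)%:R : rat) \o S) e = 'C(T.-1 - e, r.+1 + M)%:R.
  by rewrite /= addSnnS; congr ('C(_, _)%:R); lia.
rewrite altsumS (eq_altsum (fun e _ => eT e)) -addSnnS !IH; [|lia..].
have -> : (T - M = (T.-1 - M).+1)%N by lia.
rewrite binS natrD addrC addKr; congr ('C(_, _)%:R); lia.
Qed.

(** The product of the two binomials is a polynomial in e of degree p + q, which
    M differences annihilate.  By Pascal's rule one difference turns it into two
    products of total degree p + q - 1. *)
Lemma altsum_bin2 M T U p q : (M <= T)%N -> (p + q < M)%N ->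
  altsum M (fun e => 'C(T - e, p)%:R * 'C(U + e, q)%:R) = 0.
Proof.
elim: M T U p q => // M IH T U p q MT pqM.
rewrite altsumS -altsumB.
(* F p and H q stand for the binomials with lower index p - 1 and q - 1, which
   are zero when p = 0 or q = 0. *)
pose F p' e : rat := if p' is p''.+1 then 'C(T.-1 - e, p'')%:R else 0.
pose H q' e : rat := if q' is q''.+1 then 'C(U + e, q'')%:R else 0.
rewrite (@eq_altsum _ _ (fun e => F p e * 'C(U + e, q)%:R - 'C(T.-1 - e, p)%:R * H q e)); last first.
  move=> e eM /=.
  have -> : (T - e.+1 = T.-1 - e)%N by lia.
  have -> : (T - e = (T.-1 - e).+1)%N by lia.
  rewrite addnS /F /H; case: p q {pqM} => [|p] [|q]; rewrite ?bin0 ?binS ?natrD; ring.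
rewrite altsumB.
have -> : altsum M (fun e => F p e * 'C(U + e, q)%:R) = 0.
  case: p pqM => [|p] pqM; rewrite /F; last by rewrite IH //; lia.
  by rewrite /altsum big1 // => e _; rewrite mul0r mulr0.
have -> : altsum M (fun e => 'C(T.-1 - e, p)%:R * H q e) = 0.
  case: q pqM => [|q] pqM; rewrite /H; last by rewrite IH //; lia.
  by rewrite /altsum big1 // => e _; rewrite !mulr0.
by rewrite subr0.
Qed.

(** * A determinant of binomial coefficients *)

Lemma det_reverse m (A : 'M[rat]_m) :
  \det (\matrix_(i, j) A (rev_ord i) (rev_ord j)) = \det A.
Proof.
pose s := perm (@rev_ord_inj m).
have -> : \matrix_(i, j) A (rev_ord i) (rev_ord j) = row_perm s (col_perm s A).
  by apply/matrixP => i j; rewrite !mxE !permE.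
rewrite row_permE col_permE !det_mulmx !det_perm odd_permV mulrCA.
by rewrite -signr_addb addbb mulr1.
Qed.

(** By the Vandermonde convolution the matrix is a product of two unitriangular
    matrices. *)
Lemma det_pascal m y : \det (\matrix_(i < m, j < m) ('C(y + i, j)%:R : rat)) = 1.
Proof.
pose P : 'M[rat]_m := \matrix_(i, l) 'C(i, l)%:R.
pose Q : 'M[rat]_m := \matrix_(l, j) (if (l <= j)%N then 'C(y, j - l)%:R else 0).
have -> : \matrix_(i < m, j < m) 'C(y + i, j)%:R = P *m Q.
  apply/matrixP => i j; rewrite !mxE addnC -binomial.Vandermonde natr_sum.
  rewrite (big_ord_widen m (fun l => ('C(i, l) * 'C(y, j - l))%:R)) ?ltn_ord // big_mkcond.
  by apply: eq_bigr => l _; rewrite !mxE ltnS; case: ifP; rewrite ?mulr0 // natrM.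
rewrite det_mulmx -[\det Q]det_tr !det_trig.
- by rewrite !big1 ?mulr1 // => i _; rewrite !mxE ?leqnn ?subnn ?bin0 ?binn.
- by apply/is_trig_mxP => i j ij; rewrite !mxE leqNgt ij.
- by apply/is_trig_mxP => i j ij; rewrite !mxE bin_small.
Qed.

(** Combining the columns by Pascal's rule replaces column d by C(N+d, b+i).  Up
    to factors that depend only on i or only on d, this entry is
    C(N-b+m-1-i, m-1-d), and both indices can be reversed. *)
Lemma det_binomial N b m : (m <= b.+1)%N -> (b + m <= N.+1)%N ->
  \det (\matrix_(i < m, j < m) ('C(N, b + i - j)%:R : rat)) =
  \prod_(d < m) ((N + d)`!%:R * d`!%:R / ((b + d)`!%:R * (N - b + d)`!%:R)).
Proof.
move=> mb bN.
pose F : 'M[rat]_m := \matrix_(i, j) 'C(N, b + i - j)%:R.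
pose W : 'M[rat]_m := \matrix_(j, d) 'C(d, j)%:R.
pose H : 'M[rat]_m := \matrix_(i, j) 'C(N - b + i, j)%:R.
pose al : 'rV[rat]_m := \row_i ((b + i)`!%:R * (N - b + (m - i.+1))`!%:R)^-1.
pose be : 'rV[rat]_m := \row_d ((N + d)`!%:R * (m - d.+1)`!%:R).
have detW : \det W = 1.
  rewrite -det_tr det_trig; first by rewrite big1 // => i _; rewrite !mxE binn.
  by apply/is_trig_mxP => i j ij; rewrite !mxE bin_small.
have EFW : F *m W = diag_mx al *m (\matrix_(i, j) H (rev_ord i) (rev_ord j)) *m diag_mx be.
  apply/matrixP => i d; rewrite mul_mx_diag mul_diag_mx !mxE.
  transitivity ('C(N + d, b + i)%:R : rat).
    rewrite addnC -binomial.Vandermonde natr_sum.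
    have dm := ltn_ord d; have im := ltn_ord i.
    rewrite [RHS](bigID (fun j : 'I_(b + i).+1 => (j < m)%N)) /=.
    rewrite [X in _ = _ + X]big1 ?addr0; last first.
      by move=> j jm; rewrite bin_small // (leq_trans dm) // leqNgt.
    rewrite -(big_ord_widen (b + i).+1 (fun j => ('C(d, j) * 'C(N, b + i - j))%:R)); last by lia.
    by apply: eq_bigr => j _; rewrite !mxE natrM mulrC.
  have dm := ltn_ord d; have im := ltn_ord i.
  have nz k : k`!%:R != 0 :> rat by rewrite pnatr_eq0 -lt0n fact_gt0.
  have e1 : 'C(N + d, b + i)%:R * (b + i)`!%:R * (N + d - (b + i))`!%:R = (N + d)`!%:R :> rat.
    by rewrite -mulrA -!natrM bin_fact //; lia.
  have e2 : 'C(N - b + (m - i.+1), m - d.+1)%:R * (m - d.+1)`!%:R * (N + d - (b + i))`!%:R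
     = (N - b + (m - i.+1))`!%:R :> rat.
    have -> : (N + d - (b + i) = N - b + (m - i.+1) - (m - d.+1))%N by lia.
    by rewrite -mulrA -!natrM bin_fact //; lia.
  rewrite -e1 -e2.
  have := nz (b + i)%N; have := nz (N + d - (b + i))%N; have := nz (m - d.+1)%N.
  have : 'C(N - b + (m - i.+1), m - d.+1)%:R != 0 :> rat.
    by rewrite pnatr_eq0 -lt0n bin_gt0; lia.
  by move=> *; field; do ?[apply/andP; split].
have := congr1 determinant EFW.
rewrite !det_mulmx detW mulr1 det_reverse det_pascal mulr1 !det_diag => ->.
rewrite -big_split /=.
under eq_bigr => d _ do rewrite !mxE.
rewrite !big_split /= !prodfV !big_split /=.
have rev (f : nat -> rat) : \prod_(i < m) f (m - i.+1)%N = \prod_(i < m) f i.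
  rewrite (reindex_inj rev_ord_inj) /=; apply: eq_bigr => i _; congr f.
  by have := ltn_ord i; lia.
by rewrite (rev (fun k => (N - b + k)`!%:R)) (rev (fun k => k`!%:R)) mulrC.
Qed.

(** * Vectors annihilated by the bulk rows *)

(** The factorials are chosen to cancel the denominators of the binomials
    C(4n+3, 2n+3+i-j), leaving polynomials in j. *)
Definition kervec n a j : rat :=
  if (a <= j)%N then
    (-1) ^+ (j - a) * 'C(2 * n, j - a)%:R * (4 * n + 2 - j)`!%:R * (2 * n + j)`!%:R
  else 0.

Lemma sum_kervec n a (R : nat -> rat) : (a <= 2)%N ->
  \sum_(j < 2 * n + 3) R j * kervec n a j =
  altsum (2 * n) (fun e => R (a + e)%N * ((4 * n + 2 - (a + e))`!%:R * (2 * n + (a + e))`!%:R)).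
Proof.
move=> a2; rewrite -(big_mkord xpredT (fun j => R j * kervec n a j)).
rewrite (@big_cat_nat _ _ _ a) //=; last by lia.
rewrite big_nat big1 ?add0r; last first.
  by move=> j /andP[_ ja]; rewrite /kervec leqNgt ja mulr0.
rewrite -{1}[a]add0n big_addn.
rewrite (@big_cat_nat _ _ _ (2 * n).+1) //=; last by lia.
rewrite [X in _ + X]big_nat [X in _ + X]big1 ?addr0; last first.
  by move=> j /andP[ja _]; rewrite /kervec leq_addl addnK bin_small // mulr0 !mul0r mulr0.
rewrite big_mkord; apply: eq_bigr => e _.
rewrite /kervec leq_addl addnK [(e + a)%N]addnC; ring.
Qed.

(** Apart from constants and the alternating binomial, the summand is
    (4n+2-j)!/(2n+3+i-j)! times (2n+j)!/(2n-i+j)!, a polynomial in j of degree (2n-1-i) + i < 2n. *)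
Lemma kervec_bulk n a i : (a <= 2)%N -> (i < 2 * n)%N ->
  \sum_(j < 2 * n + 3) 'C(4 * n + 3, 2 * n + 3 + i - j)%:R * kervec n a j = 0.
Proof.
move=> a2 i2n.
rewrite (@sum_kervec n a (fun j => 'C(4 * n + 3, 2 * n + 3 + i - j)%:R)) //.
rewrite (@eq_altsum _ _ (fun e => ((4 * n + 3)`!%:R * (2 * n - i.+1)`!%:R * i`!%:R) *
   ('C(4 * n + 2 - a - e, 2 * n - i.+1)%:R * 'C(2 * n + a + e, i)%:R))).
  by rewrite altsumZ altsum_bin2 ?mulr0 //; lia.
move=> e en; rewrite -!natrM.
have e1 := @bin_fact (4 * n + 3) (2 * n + 3 + i - (a + e)) ltac:(lia).
have e2 := @bin_fact (4 * n + 2 - a - e) (2 * n - i.+1) ltac:(lia).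
have e3 := @bin_fact (2 * n + a + e) i ltac:(lia).
have x2 : (4 * n + 2 - a - e - (2 * n - i.+1) = 2 * n + 3 + i - (a + e))%N by lia.
have x3 : (2 * n + a + e - i = 4 * n + 3 - (2 * n + 3 + i - (a + e)))%N by lia.
rewrite x2 in e2; rewrite x3 in e3.
rewrite [(4 * n + 2 - (a + e))%N]subnDA [(2 * n + (a + e))%N]addnA -e1 -e2 -e3; congr _%:R.
set f := (2 * n + 3 + i - _)`!; set g := (4 * n + 3 - _)`!.
nia.
Qed.

Lemma kervec_left n a : (a <= 2)%N ->
  \sum_(j < 2 * n + 3) (if j <= n.+1 then 'C(3 * n + 1, n.+1 - j) else 0)%N%:R * kervec n a j =
  (3 * n + 1)`!%:R ^+ 2 * 'C(2 * n + 2 - a, n.+1)%:R.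
Proof.
move=> a2.
rewrite (@sum_kervec n a (fun j => (if j <= n.+1 then 'C(3 * n + 1, n.+1 - j) else 0)%N%:R)) //.
rewrite (@eq_altsum _ _ (fun e => (3 * n + 1)`!%:R ^+ 2 * 'C(4 * n + 2 - a - e, n.+1 + 2 * n)%:R)).
  by rewrite altsumZ altsum_bin; [congr (_ * 'C(_, _)%:R)|]; lia.
move=> e en; have x1 : (n.+1 + 2 * n = 3 * n + 1)%N by lia.
rewrite -!natrM -natrX -natrM x1; congr _%:R; case: leqP => je; last by rewrite bin_small; lia.
have e1 := @bin_fact (3 * n + 1) (n.+1 - (a + e)) ltac:(lia).
have e2 := @bin_fact (4 * n + 2 - a - e) (3 * n + 1) ltac:(lia).
have x2 : (4 * n + 2 - a - e - (3 * n + 1) = n.+1 - (a + e))%N by lia.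
have x3 : (3 * n + 1 - (n.+1 - (a + e)) = 2 * n + (a + e))%N by lia.
rewrite x2 in e2; rewrite x3 in e1; rewrite [(4 * n + 2 - (a + e))%N]subnDA -e2 expnS expn1 -{2}e1.
set f := (_ - _)`!; set g := (_ + _)`!; set h := (3 * n + 1)`!.
nia.
Qed.

Lemma kervec_right n a : (a <= 2)%N ->
  \sum_(j < 2 * n + 3) 'C(3 * n + 1, 4 * n + 2 - j)%:R * kervec n a j =
  (3 * n + 1)`!%:R ^+ 2 * 'C(2 * n + a, n.+1)%:R.
Proof.
move=> a2.
rewrite (@sum_kervec n a (fun j => 'C(3 * n + 1, 4 * n + 2 - j)%:R)) //.
rewrite (@eq_altsum _ _ (fun e => (3 * n + 1)`!%:R ^+ 2 * 'C(2 * n + a + e, n.+1 + 2 * n)%:R)).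
  rewrite altsumZ altsum_rev -signr_odd oddM mul1r.
  rewrite (@eq_altsum _ _ (fun e => 'C(4 * n + a - e, n.+1 + 2 * n)%:R)).
    by rewrite altsum_bin; [congr (_ * 'C(_, _)%:R)|]; lia.
  by move=> e en; congr ('C(_, _)%:R); lia.
move=> e en; have x1 : (n.+1 + 2 * n = 3 * n + 1)%N by lia.
rewrite -!natrM -natrX -natrM x1; congr _%:R.
case: (leqP (n.+1) (a + e)) => je; last by rewrite !bin_small; lia.
have e1 := @bin_fact (3 * n + 1) (4 * n + 2 - (a + e)) ltac:(lia).
have e2 := @bin_fact (2 * n + a + e) (3 * n + 1) ltac:(lia).
have x2 : (2 * n + a + e - (3 * n + 1) = 3 * n + 1 - (4 * n + 2 - (a + e)))%N by lia.
rewrite x2 in e2; rewrite [(2 * n + (a + e))%N]addnA -e2 expnS expn1 -{2}e1.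
set f := (4 * n + 2 - _)`!; set g := (3 * n + 1 - _)`!; set h := (3 * n + 1)`!.
nia.
Qed.

Lemma det33 (A : 'M[rat]_3) : let a i j := A (inord i) (inord j) in
  \det A = a 0%N 0%N * (a 1%N 1%N * a 2%N 2%N - a 1%N 2%N * a 2%N 1%N)
          - a 0%N 1%N * (a 1%N 0%N * a 2%N 2%N - a 1%N 2%N * a 2%N 0%N)
          + a 0%N 2%N * (a 1%N 0%N * a 2%N 1%N - a 1%N 1%N * a 2%N 0%N).
Proof.
move=> a.
have aE (i j : 'I_3) : A i j = a i j by rewrite /a !inord_val.
rewrite (expand_det_row _ ord0) !big_ord_recl big_ord0 /cofactor.
rewrite !(expand_det_row _ ord0) !big_ord_recl !big_ord0 /cofactor !det_mx11 !mxE !aE /=.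
rewrite /bump /=. ring.
Qed.

(** * The three by three reduction *)

(** The first row, the unit vector at n+1, stands for the top segment that no
    path reaches; the next two belong to the starts at height n+2, and the
    others to the bottom starts. *)
Definition path_mx n : 'M[rat]_(3 + 2 * n) := \matrix_(r, j)
  nth (fun=> 0) [:: fun j => (j == n.+1)%:R, fun j => (paths (3 * n + 1) n.+1 j)%:R,
        fun j => (paths (3 * n + 1) (4 * n + 2) j)%:R
      & [seq (fun j => (paths (4 * n + 3) a j)%:R) | a <- iota (2 * n + 3) (2 * n)]] r j.

Definition kervec_mx n : 'M[rat]_(3 + 2 * n) := \matrix_(j, c)
  if (c < 3)%N then kervec n c j else (j == c)%:R.

Lemma det_kervec_mx n :
  \det (kervec_mx n) = \prod_(a < 3) ((4 * n + 2 - a)`!%:R * (2 * n + a)`!%:R).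
Proof.
rewrite /kervec_mx det_trig; last first.
  apply/is_trig_mxP => j c jc; rewrite mxE; case: ifP => _; first by rewrite /kervec leqNgt jc.
  by rewrite -val_eqE /= ltn_eqF.
rewrite big_split_ord /= [X in _ * X]big1 ?mulr1; last by move=> i _; rewrite !mxE /= eqxx.
by apply: eq_bigr => a _; rewrite !mxE /= ltn_ord /kervec leqnn subnn bin0 expr0 !mul1r.
Qed.

(** The values of the rows of [path_mx n] on [kervec n a]; the bulk rows get the
    default value 0. *)
Definition pairing n r a : rat :=
  nth 0 [:: kervec n a n.+1; (3 * n + 1)`!%:R ^+ 2 * 'C(2 * n + 2 - a, n.+1)%:R;
           (3 * n + 1)`!%:R ^+ 2 * 'C(2 * n + a, n.+1)%:R] r.

Lemma path_mx_kervec_mx n (r : 'I_(3 + 2 * n)) (c : 'I_3) :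
  (path_mx n *m kervec_mx n) r (lshift _ c) = pairing n r c.
Proof.
rewrite mxE; under eq_bigr => j _ do rewrite !mxE /= ltn_ord.
have c2 : (c <= 2)%N by rewrite -ltnS.
case: r => r rn /=; rewrite -(big_mkord xpredT (fun j => nth (fun=> 0) _ r j * kervec n c j)).
rewrite [(3 + 2 * n)%N in LHS]addnC big_mkord.
case: r rn => [|[|[|r]]] rn; rewrite /pairing /=.
- have h : (n.+1 < 2 * n + 3)%N by lia.
  rewrite (bigD1 (Ordinal h)) //= eqxx mul1r big1 ?addr0 // => j; rewrite -val_eqE /= => /negPf->.
  by rewrite mul0r.
- exact: kervec_left.
- rewrite -(kervec_right n c2); apply: eq_bigr => j _; rewrite /paths ifT //.
  by have := ltn_ord j; lia.
- rewrite nth_nil; apply: etrans (@kervec_bulk n c r c2 _); last by lia.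
  apply: eq_bigr => j _; rewrite (nth_map 0%N) ?size_iota ?nth_iota //; [|lia..].
  by rewrite /paths ifT //; have := ltn_ord j; lia.
Qed.

(** The product of the two matrices is block upper triangular. *)
Lemma det_path_mx n :
  \det (path_mx n) * \prod_(a < 3) ((4 * n + 2 - a)`!%:R * (2 * n + a)`!%:R) =
  \det (\matrix_(r < 3, c < 3) pairing n r c) *
  \prod_(d < 2 * n) ((4 * n + 3 + d)`!%:R * d`!%:R / ((2 * n + d)`!%:R * (2 * n + 3 + d)`!%:R)).
Proof.
rewrite -det_kervec_mx -det_mulmx -[path_mx n *m _]submxK.
have -> : dlsubmx (path_mx n *m kervec_mx n) = 0.
  by apply/matrixP => i c; rewrite [LHS]mxE [LHS]mxE [LHS]path_mx_kervec_mx mxE /pairing nth_default.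
rewrite det_ublock; congr (\det _ * _).
  by apply/matrixP => r c; rewrite [LHS]mxE [LHS]mxE [LHS]path_mx_kervec_mx mxE.
have -> : drsubmx (path_mx n *m kervec_mx n) =
    \matrix_(i < 2 * n, j < 2 * n) 'C(4 * n + 3, 2 * n + i - j)%:R.
  apply/matrixP => i j; rewrite !mxE.
  rewrite (bigD1 (rshift 3 j)) //= big1 ?addr0.
    rewrite !mxE /= eqxx mulr1 add0n (nth_map 0%N) ?size_iota // nth_iota // /paths.
    have jn := ltn_ord j; rewrite ifT; last by lia.
    by congr ('C(_, _)%:R); lia.
  by move=> l lj; rewrite !mxE /= (negPf lj) mulr0.
rewrite det_binomial; [|lia..]; apply: eq_bigr => d _.
by have -> : (4 * n + 3 - 2 * n = 2 * n + 3)%N by lia.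
Qed.

(** With A = C(2n, n) and B = C(2n, n+1), and up to sign and the factor
    (3n+1)!^2 of each row, the rows are (B, -A, B), (2(A+B), A+B, B) and
    (B, A+B, 2(A+B)). *)
Lemma det_pairing n :
  `|\det (\matrix_(r < 3, c < 3) pairing n r c)| =
  (3 * n + 1)`!%:R ^+ 6 * (2 * 'C(2 * n, n)%:R + 'C(2 * n, n.+1)%:R) ^+ 2 *
    ('C(2 * n, n)%:R + 2 * 'C(2 * n, n.+1)%:R).
Proof.
rewrite det33 !mxE !inordK //.
set al := 'C(2 * n, n)%:R; set be := 'C(2 * n, n.+1)%:R; set f := (3 * n + 1)`!%:R.
have -> : pairing n 0 0 = (-1) ^+ n.+1 * f ^+ 2 * be.
  rewrite /pairing /= /kervec subn0.
  have -> : (4 * n + 2 - n.+1 = 3 * n + 1)%N by lia.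
  have -> : (2 * n + n.+1 = 3 * n + 1)%N by lia.
  rewrite -/be -/f; ring.
have -> : pairing n 0 1 = (-1) ^+ n * f ^+ 2 * al.
  rewrite /pairing /= /kervec /= subn1 /=.
  have -> : (4 * n + 2 - n.+1 = 3 * n + 1)%N by lia.
  have -> : (2 * n + n.+1 = 3 * n + 1)%N by lia.
  rewrite -/al -/f; ring.
have -> : pairing n 0 2 = (-1) ^+ n.+1 * f ^+ 2 * be.
  rewrite /pairing /= /kervec /be; case: n {al be} @f => [|n] f; first by rewrite /= mulr0.
  have -> : (4 * n.+1 + 2 - n.+2 = 3 * n.+1 + 1)%N by lia.
  have -> : (2 * n.+1 + n.+2 = 3 * n.+1 + 1)%N by lia.
  rewrite !subSS subn0 -/f -(@bin_sub (2 * n.+1) n); last by lia.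
  have -> : (2 * n.+1 - n = n.+2)%N by lia.
  rewrite ltnS /= !exprS; ring.
have eg : 'C(2 * n + 1, n.+1)%:R = al + be by rewrite addn1 binS natrD addrC.
have eg2 : 'C(2 * n + 2, n.+1)%:R = 2 * (al + be) :> rat.
  have -> : (2 * n + 2 = (2 * n + 1).+1)%N by lia.
  rewrite binS natrD eg -(@bin_sub _ n); last by lia.
  have -> : (2 * n + 1 - n = n.+1)%N by lia.
  rewrite eg; ring.
rewrite /pairing /= subn0 addn0 -/f -/be.
have -> : (2 * n + 2 - 1 = 2 * n + 1)%N by lia.
have -> : (2 * n + 2 - 2 = 2 * n)%N by lia.
rewrite eg eg2 -/be.
transitivity `|(-1) ^+ n.+1 * (f ^+ 6 * (2 * al + be) ^+ 2 * (al + 2 * be))|.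
  by congr `|_|; rewrite exprS; ring.
rewrite normrM normrX normrN1 expr1n mul1r ger0_norm //.
by rewrite !mulr_ge0 ?exprn_ge0 ?addr_ge0 ?mulr_ge0 ?ler0n.
Qed.

(** * From the path determinant to the full matrix *)

Lemma norm_det_perm (T : eqType) (x0 : T) k (s t : seq T) (F : T -> nat -> rat) :
  perm_eq s t -> size s = k ->
  `|\det (\matrix_(i < k, j < k) F (nth x0 s i) j)| =
  `|\det (\matrix_(i < k, j < k) F (nth x0 t i) j)|.
Proof.
move=> st szs; have szt : size t == k by rewrite -(perm_size st) szs.
have /tuple_permP[p sE] : perm_eq s (Tuple szt) by [].
have -> : \matrix_(i < k, j < k) F (nth x0 s i) j =
    row_perm p (\matrix_(i < k, j < k) F (nth x0 t i) j).
  apply/matrixP => i j; rewrite !mxE sE; congr (F _ j).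
  by rewrite -tnth_nth tnth_mktuple (tnth_nth x0).
by rewrite row_permE det_mulmx det_perm normrM normrX normrN1 expr1n mul1r.
Qed.

Lemma det_unit_row k p (G : nat -> nat -> rat) : (p <= k)%N ->
  \det (\matrix_(r < k.+1, c < k.+1) (if (r : nat) is r'.+1 then G r' c else (c == p :> nat)%:R)) =
  (-1) ^+ p * \det (\matrix_(r < k, c < k) G r (bump p c)).
Proof.
move=> pk; rewrite (expand_det_row _ ord0) (bigD1 (Ordinal (pk : p < k.+1)%N)) //= big1 ?addr0.
  rewrite !mxE eqxx mul1r /cofactor add0n; congr (_ * \det _).
  by apply/matrixP => r c; rewrite !mxE.
by move=> c; rewrite -val_eqE /= => /negPf cp; rewrite mxE cp mul0r.
Qed.

(** Signs need no attention, since the number of tilings is nonnegative. *)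
Lemma norm_det_path_mx n :
  `|\det (path_mx n)| =
  `|seq_det (2 * n + 2)
    [seq arrivals (all_starts n) (4 * n + 3) (bump n.+1 j) | j <- iota 0 (2 * n + 2)]|.
Proof.
pose F (st : nat * nat) j : rat := (paths (4 * n + 3 - st.2) st.1 j)%:R.
pose st := [:: (n.+1, n.+2), ((4 * n + 2)%N, n.+2) & bottom_starts n].
have szst : size (all_starts n) = (2 + 2 * n)%N.
  by rewrite /= size_rcons size_bottom.
have -> : \det (path_mx n) =
    (-1) ^+ n.+1 * \det (\matrix_(r < 2 + 2 * n, c < 2 + 2 * n) F (nth (0, 0)%N st r) (bump n.+1 c)).
  rewrite -(@det_unit_row _ _ (fun r c => F (nth (0, 0)%N st r) c)); last by lia.
  congr (\det _); apply/matrixP => -[r rn] c; rewrite !mxE /=.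
  case: r rn => [|[|[|r]]] rn //=.
  - by rewrite /F /=; congr (paths _ _ _)%:R; lia.
  - by rewrite /F /=; congr (paths _ _ _)%:R; lia.
  by rewrite (nth_map 0%N) ?size_iota ?nth_bottom ?nth_iota // /F ?subn0.
rewrite normrM normrX normrN1 expr1n mul1r addnC.
rewrite (@norm_det_perm _ _ _ st (all_starts n) (fun s j => F s (bump n.+1 j))).
- congr `|_|; rewrite /seq_det -det_tr; congr (\det _); apply/matrixP => i j; rewrite !mxE.
  rewrite (nth_map 0%N) ?size_iota // nth_iota // /arrivals.
  by rewrite /F; case: nth.
- by rewrite perm_cons perm_sym perm_rcons.
- by rewrite /= size_bottom addn2.
Qed.

(** * The product formula *)

Definition superfact m : rat := \prod_(0 <= k < m) k`!%:R.

Lemma superfactS m : superfact m.+1 = superfact m * m`!%:R.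
Proof. by rewrite /superfact big_nat_recr. Qed.

Lemma superfact_neq0 m : superfact m != 0.
Proof. by rewrite /superfact prodf_seq_neq0; apply/allP => k _; rewrite pnatr_eq0 -lt0n fact_gt0. Qed.

Lemma prod_fact_shift c m : \prod_(d < m) (c + d)`!%:R = superfact (c + m) / superfact c.
Proof.
apply: (mulIf (superfact_neq0 c)); rewrite divfK ?superfact_neq0 //.
elim: m => [|m IH]; first by rewrite big_ord0 mul1r addn0.
by rewrite big_ord_recr /= addnS superfactS -IH; ring.
Qed.

Lemma rising_fact x m : (rising x.+1 m * x`! = (x + m)`!)%N.
Proof.
rewrite /rising; elim: m => [|m IH]; first by rewrite big_ord0 mul1n addn0.
by rewrite big_ord_recr /= addnS factS -IH mulnAC mulnC addSn.
Qed.

Theorem corollary2 (n : nat) :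
  #|rhombus_tilings (holey_hexagon n)|%:R =
    (rising (n + 2) (2 * n))%:R ^+ 6
    * (((\prod_(0 <= k < (2 * n).+1) k`!%:R) ^+ 3
        * \prod_(0 <= k < (6 * n + 2).+1) k`!%:R)
       / (\prod_(0 <= k < (4 * n + 2).+1) k`!%:R) ^+ 3)
    * (n + 1)%:R ^+ 3 * (3 * n + 1)%:R * (3 * n + 2)%:R ^+ 2 :> rat.
Proof.
rewrite holey_hexagonE -/(tilings _ _).
rewrite -/(superfact (2 * n).+1) -/(superfact (6 * n + 2).+1) -/(superfact (4 * n + 2).+1).
have Tdet : (tilings (4 * n + 3) (holey n))%:R = `|\det (path_mx n)|.
  by rewrite norm_det_path_mx -holey_det normr_nat.
have := congr1 Num.norm (det_path_mx n); rewrite 2!normrM -Tdet det_pairing.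
have nz k : k`!%:R != 0 :> rat by rewrite pnatr_eq0 -lt0n fact_gt0.
rewrite ger0_norm; last by apply: prodr_ge0 => i _; rewrite mulr_ge0 ?ler0n.
rewrite ger0_norm; last by apply: prodr_ge0 => i _; rewrite ?(divr_ge0, mulr_ge0, ler0n).
rewrite !big_split /= prodfV big_split /= (prod_fact_shift 0 (2 * n)) !prod_fact_shift.
rewrite !big_ord_recl !big_ord0 /= /bump /=.
have sf3 m : superfact (m + 3) = superfact m * m`!%:R * (m + 1)`!%:R * (m + 2)`!%:R.
  by rewrite addn3 !superfactS addn1 addn2.
have -> : (4 * n + 3 + 2 * n = (6 * n + 2).+1)%N by lia.
have -> : (2 * n + 3 + 2 * n = 4 * n + 3)%N by lia.
have -> : (2 * n + 2 * n = 4 * n)%N by lia.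
have -> : ((4 * n + 2).+1 = 4 * n + 3)%N by lia.
have -> : (4 * n + 2 - 1 = 4 * n + 1)%N by lia.
have -> : (4 * n + 2 - (1 + 0).+1 = 4 * n)%N by lia.
rewrite add0n subn0 !sf3 [superfact (6 * n + 2).+1]superfactS [superfact (2 * n).+1]superfactS mulr1.
rewrite [superfact 0](_ : _ = 1); last by rewrite /superfact big_geq.
(* With A = C(2n, n) and B = C(2n, n+1), everything is expressed by A, n!,
   the factor [rising (n + 2) (2 * n)] and superfactorials, since
   (2n)! = A n!^2 and (n+1) B = n A. *)
have eal : 'C(2 * n, n)%:R * (n`!%:R * n`!%:R) = (2 * n)`!%:R :> rat.
  have := @bin_fact (2 * n) n; rewrite (_ : (2 * n - n = n)%N); last by lia.
  by move=> <-; [rewrite !natrM|lia].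
have ebe : (n + 1)%:R * 'C(2 * n, n.+1)%:R = n%:R * 'C(2 * n, n)%:R :> rat.
  by rewrite -!natrM addn1 mul_bin_left; congr (_ * _)%N%:R; lia.
have eri : (rising (n + 2) (2 * n))%:R * ((n + 1)%:R * n`!%:R) = (3 * n + 1)`!%:R :> rat.
  rewrite -!natrM addn2 addn1 -factS rising_fact; congr (_`!%:R); lia.
rewrite -!eri -!eal.
move: (nz n) (nz (2 * n + 1)%N) (nz (2 * n + 2)%N) (nz (4 * n)%N) (nz (4 * n + 1)%N) (nz (4 * n + 2)%N).
move: (superfact_neq0 (2 * n)) (superfact_neq0 (4 * n)).
have n1 : n%:R + 1 != 0 :> rat by rewrite natr1 pnatr_eq0.
have al0 : 'C(2 * n, n)%:R != 0 :> rat by rewrite pnatr_eq0 -lt0n bin_gt0; lia.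
have {ebe} -> : 'C(2 * n, n.+1)%:R = n%:R * 'C(2 * n, n)%:R / (n%:R + 1) :> rat.
  by rewrite -ebe natrD; field.
rewrite [(n + 1)%:R]natrD [(3 * n + 1)%:R]natrD [(3 * n + 2)%:R]natrD [(3 * n)%:R]natrM.
move: al0; set al := 'C(2 * n, n)%:R; set m := n`!%:R.
set p1 := (2 * n + 1)`!%:R; set p2 := (2 * n + 2)`!%:R.
set q0 := (4 * n)`!%:R; set q1 := (4 * n + 1)`!%:R; set q2 := (4 * n + 2)`!%:R.
set X := superfact (2 * n); set Y := superfact (4 * n); set Z := superfact _; set r := (rising _ _)%:R.
set T := (tilings _ _)%:R.
move: n1; set k : rat := n%:R => n1 al0 X0 Y0 m0 p10 p20 q00 q10 q20 E.
apply: (mulIf (_ : q2 * (q1 * q0) * (X * (al * (m * m)) * p1 * p2 / X) != 0)).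
  by rewrite !mulf_neq0 ?invr_eq0.
rewrite E; field.
by do ?[apply/andP; split].
Qed.
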